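(* There is an absolute constant $c$ such that the following holds. Let $X=(x_1,\dots,x_n)$ be an $n\times n$ real matrix with $s$-sparse column vectors $x_1,\dots,x_n$, let $r$ be the cardinality of $\{j:|x_j|_1=\max_k|x_k|_1\}$, and let $A=[A_{ki}]$, $B=[B_{lj}]$ be independent $m\times n$ random matrices whose entries are i.i.d. $N(0,1)$. Then $$W^2(\Gamma_X;\Phi_{A,B})\le1+n^2-r\big(n-s\log^2(cn^2r)\big).$$ In particular, when $r=n$ (i.e., $X$ is sparse and $l_1$-column-flat), $$W^2(\Gamma_X;\Phi_{A,B})\le1+ns\log^2(cn^3).$$
   Context: For $Z=(z_1,\dots,z_n)\in\mathbb{R}^{n\times n}$ with columns $z_j$, $|||Z|||_1:=\max_j|z_j|_1$. A vector is $s$-sparse if it has at most $s$ nonzero components; $X$ is $l_1$-column-flat if all $|x_j|_1$ are equal. $\Gamma_X:=D(|||\cdot|||_1,X)=\{V\in\mathbb{R}^{n\times n}:|||X+tV|||_1\le|||X|||_1\text{ for some }t>0\}$. $\Phi_{A,B}:\mathbb{R}^{n\times n}\to\mathbb{R}^{m\times m}$ is the operator $Z\mapsto AZB^T$. Its width is $W(\Gamma_X;\Phi_{A,B}):=E_H[\sup\{\langle H,U\rangle:U\in\Gamma_X,\ |U|_F=1\}]$, where $H:=m^{-1}A^T\mathcal{E}B$ and $\mathcal{E}=[\varepsilon_{kl}]$ is an $m\times m$ matrix of i.i.d. Rademacher variables ($P[\varepsilon_{kl}=\pm1]=1/2$) independent of $A$ and $B$; $\langle H,U\rangle=\mathrm{tr}(H^TU)$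 and $|\cdot|_F$ is the Frobenius norm. *)

(* Defs.v *)
From HB Require Import structures.
From mathcomp Require Import all_boot all_order all_algebra.
From mathcomp Require Import all_classical all_reals all_analysis.
Set Implicit Arguments.
Unset Strict Implicit.
Unset Printing Implicit Defensive.
Import Order.TTheory GRing.Theory Num.Theory.
Local Open Scope classical_set_scope.
Local Open Scope ring_scope.

Section Norms.
Variable R : realType.

Definition l1norm (n : nat) (v : 'cV[R]_n) : R := \sum_(i < n) `|v i 0|.

(* [|||Z|||_1]; since l1 norms are nonnegative, the neutral element 0 does not
   affect the maximum as soon as there is at least one column. *)
Definition max_col_l1norm (n : nat) (Z : 'M[R]_n) : R :=
  \big[Num.max/0]_(j < n) l1norm (col j Z).

Definition sparse (s n : nat) (v : 'cV[R]_n) : Prop :=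
  (#|[set i : 'I_n | (v i 0 != 0)%R]%SET| <= s)%N.

Definition max_cols (n : nat) (X : 'M[R]_n) : {set 'I_n} :=
  [set j | l1norm (col j X) == max_col_l1norm X]%SET.

Definition frobenius_dot (n : nat) (H U : 'M[R]_n) : R := \tr (H^T *m U).

Definition frobenius_norm (n : nat) (U : 'M[R]_n) : R :=
  Num.sqrt (frobenius_dot U U).

Definition descent_cone (n : nat) (f : 'M[R]_n -> R) (X : 'M[R]_n) :
    set 'M[R]_n :=
  [set V | exists2 t : R, 0 < t & f (X + t *: V) <= f X].

Definition Gamma (n : nat) (X : 'M[R]_n) : set 'M[R]_n :=
  descent_cone (@max_col_l1norm n) X.

End Norms.

Section Random.
Context (d : measure_display) (T : measurableType d) (R : realType).
Variable P : probability T R.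

Definition mutually_independent (I : finType) (X : I -> {RV P >-> R}) : Prop :=
  forall (J : {set I}) (V : I -> set R), (forall i, measurable (V i)) ->
    P (\bigcap_(i in [set` J]) (X i @^-1` V i)) =
    (\prod_(i in J) P (X i @^-1` V i))%E.

(* The sigma-algebra generated by a family of random variables. *)
Definition sigma_of (I : finType) (X : I -> {RV P >-> R}) : set (set T) :=
  <<s \bigcup_(i in [set: I]) preimage_set_system [set: T] (X i) measurable >>.

Definition independent_systems (F G : set (set T)) : Prop :=
  forall a b, F a -> G b -> P (a `&` b) = (P a * P b)%E.

Definition std_normal (Y : {RV P >-> R}) : Prop :=
  forall V : set R, measurable V -> distribution P Y V = normal_prob 0 1 V.

Definition rademacher (Y : {RV P >-> R}) : Prop :=
  P [set w | Y w = 1] = (2^-1)%:E /\ P [set w | Y w = -1] = (2^-1)%:E.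

Definition random_mx (m n : nat) (A : 'I_m * 'I_n -> {RV P >-> R}) (w : T) :
    'M[R]_(m, n) :=
  \matrix_(k < m, i < n) A (k, i) w.

(* [H = m^-1 A^T E B], i.e., [m^-1] times the image of [E] under the adjoint of
   the operator [Z |-> A Z B^T]. *)
Definition noise_mx (m n : nat) (A B : 'I_m * 'I_n -> {RV P >-> R})
    (E : 'I_m * 'I_m -> {RV P >-> R}) (w : T) : 'M[R]_n :=
  m%:R^-1 *: ((random_mx A w)^T *m random_mx E w *m random_mx B w).

(* The expectation is over the joint law of [A], [B] and [E]. The set under
   [sup] is bounded by the Frobenius norm of [H]. It is empty when the cone is
   contained in {0} (for [Gamma X], this happens only when [X] = 0), in which
   case [sup] is 0. *)
Definition width (m n : nat) (C : set 'M[R]_n)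
    (A B : 'I_m * 'I_n -> {RV P >-> R}) (E : 'I_m * 'I_m -> {RV P >-> R}) :
    \bar R :=
  let S := C `&` [set U | frobenius_norm U = 1] in
  'E_P[fun w => sup [set frobenius_dot (noise_mx A B E w) U | U in S]]%E.

End Random.

(* Main.v *)
(* Let h be an entry of H. Conditionally on the signs and on B, h is a centered
   Gaussian in the column of A, so that E exp(u h) = E exp(u^2 avg_k g_k^2 / 2)
   with g_k = m^(-1/2) sum_l eps_kl b_l. Convexity of exp bounds this by the
   average of the E exp(u^2 g_k^2 / 2), and each g_k is a standard Gaussian
   given the signs: hence E exp(u h) <= (1 - u^2)^(-1/2) for |u| < 1. This bound
   alone gives E h = 0, E h^2 <= 1 and, with u = 4/5,
   E max(|h| - t, 0)^2 <= (125/12) exp(- 4t/5).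

   If U is in the descent cone and column j of X has maximal norm, column j of U
   makes a nonpositive product with every subgradient of the l1 norm at x_j.
   Subtracting t times a subgradient adapted to H (the sign on the support of
   x_j, H/t truncated to [-1, 1] off the support) from these columns of H
   therefore does not decrease <H, U>. So <H, U> is at most the Frobenius norm
   of the difference, whose square has mean at most
   n(n - r) + r(s(1 + t^2) + n (125/12) exp(- 4t/5)). The choice
   t = ln(c n^2 r) - 1 with c = exp 10 makes the last term at most 1. *)

Require Import Defs.
From HB Require Import structures.
From mathcomp Require Import all_boot all_order all_algebra.
From mathcomp Require Import all_classical all_reals all_analysis.
From mathcomp Require Import measurable_realfun ring lra.
Set Implicit Arguments.
Unset Strict Implicit.
Unset Printing Implicit Defensive.
Import Order.TTheory GRing.Theory Num.Theory.
Local Open Scope classical_set_scope.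
Local Open Scope ring_scope.

(** * Gaussian integrals: densities, and exponential moments of [g] and of [g^2 / 2] *)

Section GaussianIntegrals.
Context {R : realType}.
Local Notation mu := (@lebesgue_measure R).

(** [normal_pdf] and the Radon-Nikodym derivative of [normal_prob] have the same integral over every
    measurable set, so they agree almost everywhere. *)
Lemma integral_normal_prob (p s : R) (f : R -> \bar R) : s != 0 ->
  measurable_fun [set: R] f -> (forall x, 0 <= f x)%E ->
  (\int[normal_prob p s]_x f x = \int[mu]_x (f x * (normal_pdf p s x)%:E))%E.
Proof.
move=> s0 mf f0.
have dom := @normal_prob_dominates R p s.
rewrite -(Radon_Nikodym_SigmaFinite.change_of_variables dom)//.
have mg := measurable_int _ (Radon_Nikodym_SigmaFinite.f_integrable dom).
have mp : measurable_fun setT (fun x => (normal_pdf p s x)%:E).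
  by apply/measurable_EFinP; exact: measurable_normal_pdf.
apply: ae_eq_integral => //.
- exact: emeasurable_funM.
- exact: emeasurable_funM.
- apply: ae_eqe_mul2l.
  apply: integral_ae_eq => //=.
  + exact: Radon_Nikodym_SigmaFinite.f_integrable.
  + by move=> E _ mE; rewrite -Radon_Nikodym_SigmaFinite.f_integral.
Qed.

(** Completing the square: [x y - x^2 / 2 = y^2 / 2 - (x - y)^2 / 2]. *)
Lemma expR_mul_normal_pdf (x y : R) :
  expR (x * y) * normal_pdf 0 1 x = expR (y ^+ 2 / 2) * normal_pdf y 1 x.
Proof.
rewrite !normal_pdfE ?oner_neq0//= mulrCA [RHS]mulrCA /normal_fun -!expRD.
by congr (_ * expR _); field.
Qed.

(** The exponents add up to [- (1 - u) x^2 / 2], that of a centered Gaussian of variance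
    [1 / (1 - u)]; the factor [s] corrects the peak. *)
Lemma expR_sqr_mul_normal_pdf (u x : R) : u < 1 ->
  let s := (Num.sqrt (1 - u))^-1 in
  expR (u * (x ^+ 2 / 2)) * normal_pdf 0 1 x = s * normal_pdf 0 s x.
Proof.
move=> u1 s.
have v0 : 0 < 1 - u by rewrite subr_gt0.
have s0 : 0 < s by rewrite invr_gt0 sqrtr_gt0.
have s2 : s ^+ 2 = (1 - u)^-1 by rewrite exprVn sqr_sqrtr// ltW.
rewrite !normal_pdfE ?oner_neq0 ?gt_eqF//= mulrCA [RHS]mulrA /normal_fun -expRD.
congr (_ * expR _).
  rewrite /normal_peak expr1n mul1r -mulrnAr sqrtrM ?sqr_ge0// sqrtr_sqr gtr0_norm//.
  by rewrite invfM mulVKf// gt_eqF.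
rewrite s2 subr0; field.
by rewrite gt_eqF.
Qed.

Lemma normal_mgf (y : R) :
  (\int[normal_prob 0 1]_x (expR (x * y))%:E = (expR (y ^+ 2 / 2))%:E)%E.
Proof.
have mf : measurable_fun [set: R] (fun x : R => (expR (x * y))%:E).
  apply/measurable_EFinP; apply: measurableT_comp => //.
  exact: measurable_funM.
rewrite integral_normal_prob ?oner_neq0//.
under eq_integral do rewrite -EFinM expR_mul_normal_pdf EFinM.
rewrite integralZl//; last exact: integrable_normal_pdf.
by rewrite integral_normal_pdf mule1.
Qed.

Lemma normal_sqr_mgf (u : R) : u < 1 ->
  (\int[normal_prob 0 1]_x (expR (u * (x ^+ 2 / 2)))%:E =
   ((Num.sqrt (1 - u))^-1)%:E)%E.
Proof.
move=> u1.
have mf : measurable_fun [set: R] (fun x : R => (expR (u * (x ^+ 2 / 2)))%:E).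
  apply/measurable_EFinP; apply: measurableT_comp => //.
  by apply: measurable_funM => //; exact: measurable_funM.
rewrite integral_normal_prob ?oner_neq0//.
under eq_integral do rewrite -EFinM expR_sqr_mul_normal_pdf// EFinM.
rewrite integralZl//; last exact: integrable_normal_pdf.
by rewrite integral_normal_pdf mule1.
Qed.

End GaussianIntegrals.

(* [R] carries two measurable structures that differ only by their display: the
   one of [{RV P >-> R}] and the one of [normal_prob]. *)
Lemma integral_std_normal (d : measure_display) (T : measurableType d)
    (R : realType) (P : probability T R) (Y : {RV P >-> R}) (f : R -> \bar R) :
  std_normal Y -> measurable_fun [set: R] f -> (forall x, 0 <= f x)%E ->
  (\int[distribution P Y]_x f x = \int[normal_prob 0 1]_x f x)%E.
Proof.
move=> nY mf f0.
pose idR : {mfun measurableTypeR R >-> R} :=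
  HB.pack (idfun : measurableTypeR R -> R)
    (isMeasurableFun.Build _ _ (measurableTypeR R) R _ (@measurable_id _ _ setT)).
transitivity (\int[distribution (normal_prob 0 1) idR]_x f x)%E.
  by apply: eq_measure_integral => A mA _; exact: nY.
by rewrite ge0_integral_distribution.
Qed.

(** * Integrating out one variable of an independent family *)

Section Independence.
Context {d : measure_display} {T : measurableType d} {R : realType}.
Context {P : probability T R} {I : finType}.
Variable X : I -> {RV P >-> R}.

Definition others (i : I) : set (set T) :=
  \bigcup_(j in [set j | j != i])
    preimage_set_system [set: T] (X j) measurable.

(** The sample space carries here the coarser sigma-algebra generated by the [X j] with [j != i].
    Measurability on this type expresses that a function of [w] does not involve [X i]. *)
Definition others_type (i : I) := g_sigma_algebraType (others i).

HB.instance Definition _ i := Measurable.on (others_type i).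

Lemma others_measurable (i : I) (b : set T) : <<s others i >> b -> measurable b.
Proof.
move: b; apply: smallest_sub; first exact: sigma_algebra_measurable.
by move=> b [j _ [V mV <-]]; rewrite setTI; exact: measurable_funPTI.
Qed.

Lemma measurable_others (i j : I) : j != i ->
  measurable_fun [set: others_type i] (X j : others_type i -> R).
Proof.
by move=> ji _ V mV; apply: sub_sigma_algebra; exists j => //; exists V.
Qed.

Hypothesis indX : mutually_independent X.

(** Both sides are finite measures in [b]. They agree on the cylinders with no constraint on [X i],
    a pi-system containing the generators of [others i] up to sigma-closure, hence on the whole
    sigma-algebra. *)
Lemma independent_others (i : I) (V : set R) (b : set T) :
  measurable V -> <<s others i >> b ->
  P (X i @^-1` V `&` b) = (P (X i @^-1` V) * P b)%E.
Proof.
move=> mV sb.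
have mXV : measurable (X i @^-1` V) by exact: measurable_funPTI.
pose rect := [set b : set T | exists W : I -> set R,
  [/\ forall j, measurable (W j), W i = setT &
      b = \bigcap_(j in [set: I]) (X j @^-1` W j)]].
have rectm : rect `<=` measurable.
  move=> _ [W [mW _ ->]]; apply: fin_bigcap_measurable => // j _.
  exact: measurable_funPTI.
have rectI : setI_closed rect.
  move=> _ _ [W [mW Wi ->]] [W' [mW' Wi' ->]].
  exists (fun j => W j `&` W' j); split.
  - by move=> j; exact: measurableI.
  - by rewrite Wi Wi' setIT.
  - by rewrite -bigcapI; apply: eq_bigcapr => j _; rewrite preimage_setI.
have others_rect : <<s others i >> `<=` <<s rect >>.
  apply: smallest_sub; first exact: smallest_sigma_algebra.
  move=> _ [j ji [W mW <-]]; apply: sub_sigma_algebra.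
  exists (fun k => if k == j then W else setT); split.
  - by move=> k; case: ifP.
  - by rewrite eq_sym (negbTE ji).
  - rewrite setTI; apply/seteqP; split => [w Ww k _/=|w /(_ j Logic.I)/=].
      by case: eqP => // ->.
    by rewrite eqxx.
(* Mutual independence is used on the full index set twice: with [V] at index [i], and with [setT]
   there, which contributes a factor 1. *)
have rule b' : rect b' -> P (X i @^-1` V `&` b') = (P (X i @^-1` V) * P b')%E.
  move=> [W [mW Wi ->]].
  have setE (K : I -> set R) : \bigcap_(j in [set` [set: I]%SET]) (X j @^-1` K j) =
      \bigcap_(j in [set: I]) (X j @^-1` K j).
    by congr bigcap; apply/seteqP; split=> // j _ /=; rewrite inE.
  have -> : X i @^-1` V `&` \bigcap_(j in [set: I]) (X j @^-1` W j) =
      \bigcap_(j in [set: I]) (X j @^-1` (if j == i then V else W j)).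
    apply/seteqP; split => [w [Vw Ww] j _/=|w Kw].
      by case: eqP => [->//|_]; exact: Ww.
    split; first by have := Kw i Logic.I; rewrite /= eqxx.
    move=> j _; have := Kw j Logic.I => /=; case: eqP => // -> _.
    by rewrite Wi.
  rewrite -!setE !indX//; last by move=> j; case: ifP.
  rewrite (bigD1 i)//= [in RHS](bigD1 i)//= eqxx Wi preimage_setT probability_setT mul1e.
  by congr (_ * _)%E; apply: eq_bigr => j /andP[_ /negbTE ->].
have PVfin : P (X i @^-1` V) \is a fin_num by exact: fin_num_measure.
have PV0 : 0 <= fine (P (X i @^-1` V)) by exact: fine_ge0.
pose m2 := mscale (NngNum PV0) P.
have m2E c : m2 c = (P (X i @^-1` V) * P c)%E by rewrite /m2 /mscale/= fineK.
pose m1 := mrestr P mXV.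
have m1E c : m1 c = P (X i @^-1` V `&` c) by rewrite /m1 /mrestr setIC.
rewrite -m1E -m2E.
have rectE : [set c | rect c /\ c `<=` setT] = rect.
  by apply/seteqP; split => [c []//|c rc]; split.
apply: (g_sigma_algebra_measure_unique_trace rect setT) => //; rewrite ?rectE//.
- by rewrite -[LHS]/(m1 setT) -[RHS]/(m2 setT) m1E m2E setIT probability_setT mule1.
- by move=> c rc; rewrite -[LHS]/(m1 c) -[RHS]/(m2 c) m1E m2E; exact: rule.
- by rewrite -[X in (X < _)%E]/(m1 setT) m1E setIT ltey_eq fin_num_measure.
- exact: others_rect.
Qed.

(** By [independent_others], the law of [w |-> (X i w, w)], with [w] read in [others_type i], is a
    product measure, and Tonelli integrates the first coordinate alone. This stands in for
    conditioning on the other variables. *)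
Lemma freeze (i : I) (F : R * others_type i -> \bar R) :
  measurable_fun setT F -> (forall z, 0 <= F z)%E ->
  (\int[P]_w F (X i w, w) =
   \int[P]_w \int[distribution P (X i)]_x F (x, w))%E.
Proof.
move=> mF F0.
have mid : measurable_fun [set: T] (idfun : T -> others_type i).
  by move=> _ b sb; rewrite setTI; exact: (others_measurable sb).
pose idm : {mfun T >-> others_type i} :=
  HB.pack (idfun : T -> others_type i) (isMeasurableFun.Build _ _ _ _ _ mid).
pose phi (w : T) : R * others_type i := (X i w, w).
have mphi : measurable_fun setT phi by exact: measurable_fun_pair.
pose phim : {mfun T >-> (R * others_type i)%type} :=
  HB.pack phi (isMeasurableFun.Build _ _ _ _ _ mphi).
transitivity (\int[distribution P phim]_z F z)%E.
  by rewrite ge0_integral_distribution.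
transitivity (\int[distribution P (X i) \x distribution P idm]_z F z)%E.
  apply: eq_measure_integral => C mC _; apply/esym.
  apply: product_measure_unique => // A B mA mB.
  exact: independent_others.
rewrite fubini_tonelli2//.
rewrite ge0_integral_distribution//.
- exact: measurable_fun_fubini_tonelli_G.
- by move=> y; apply: integral_ge0 => x _.
Qed.

Lemma gaussian_elim (i : I) (Y Z : T -> R) : std_normal (X i) ->
  measurable_fun [set: others_type i] (Y : others_type i -> R) ->
  measurable_fun [set: others_type i] (Z : others_type i -> R) ->
  (\int[P]_w (expR (X i w * Y w + Z w))%:E =
   \int[P]_w (expR (Y w ^+ 2 / 2 + Z w))%:E)%E.
Proof.
move=> nX mY mZ.
pose F (z : R * others_type i) := (expR (z.1 * Y z.2 + Z z.2))%:E.
have mF : measurable_fun setT F.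
  apply/measurable_EFinP; apply: measurableT_comp => //.
  apply: measurable_funD; last exact: (measurableT_comp mZ).
  by apply: measurable_funM => //; exact: (measurableT_comp mY).
rewrite (freeze mF)//; last by move=> z; rewrite lee_fin expR_ge0.
apply: eq_integral => w _.
transitivity (\int[normal_prob 0 1]_x F (x, w))%E.
  apply: integral_std_normal => //; last by move=> x; rewrite lee_fin expR_ge0.
  exact: (measurableT_comp mF).
under eq_integral do rewrite /F/= expRD mulrC EFinM.
rewrite ge0_integralZl//; first by rewrite normal_mgf -EFinM -expRD addrC.
by apply/measurable_EFinP; apply: measurableT_comp => //; exact: measurable_funM.
Qed.

(** The variables are integrated out one at a time. The term [Y k ^+ 2 / 2] left by each joins [Z],
    so the induction runs over all [Z]. *)
Lemma gaussian_elim_seq (K : eqType) (a : K -> I) (s : seq K)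
    (Y : K -> T -> R) (Z : T -> R) : uniq s -> injective a ->
  (forall k, std_normal (X (a k))) ->
  (forall k l,
    measurable_fun [set: others_type (a k)] (Y l : others_type (a k) -> R)) ->
  (forall k,
    measurable_fun [set: others_type (a k)] (Z : others_type (a k) -> R)) ->
  (\int[P]_w (expR (\sum_(k <- s) X (a k) w * Y k w + Z w))%:E =
   \int[P]_w (expR (\sum_(k <- s) Y k w ^+ 2 / 2 + Z w))%:E)%E.
Proof.
move=> us inja nX mY; elim: s Z us => [|k s IH] Z.
  by move=> _ _; apply: eq_integral => w _; rewrite !big_nil.
move=> /= /andP[kNs us] mZ.
under eq_integral do rewrite big_cons -addrA.
rewrite (@gaussian_elim (a k))//; last first.
  apply: measurable_funD => //.
  (* The test [l \in s] is kept inside each summand: with [uniq] it yields [l != k], so that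
     [X (a l)] is measurable for [others_type X (a k)]. *)
  rewrite (_ : (fun w => _) = fun w =>
      \sum_(l <- s) if l \in s then X (a l) w * Y l w else 0); last first.
    by apply/funext => w; apply: eq_big_seq => l ->.
  apply: measurable_sum => l; have [ls|//] := boolP (l \in s).
  apply: measurable_funM => //; apply: measurable_others.
  by rewrite (inj_eq inja); apply: contraNneq kNs => <-.
under eq_integral do rewrite addrCA.
rewrite IH//.
- by apply: eq_integral => w _; rewrite big_cons addrCA addrA.
- move=> l; apply: measurable_funD => //.
  by apply: measurable_funM => //; exact: measurable_funX.
Qed.

Lemma gaussian_elim_sum (K : finType) (a : K -> I) (Y : K -> T -> R) :
  injective a -> (forall k, std_normal (X (a k))) ->
  (forall k l,
    measurable_fun [set: others_type (a k)] (Y l : others_type (a k) -> R)) ->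
  (\int[P]_w (expR (\sum_k X (a k) w * Y k w))%:E =
   \int[P]_w (expR (\sum_k Y k w ^+ 2 / 2))%:E)%E.
Proof.
move=> inja nX mY.
have := gaussian_elim_seq (Z := cst 0) (index_enum_uniq K) inja nX mY.
have -> : (fun w => (expR (\sum_k X (a k) w * Y k w + cst 0 w))%:E) =
    fun w => (expR (\sum_k X (a k) w * Y k w))%:E.
  by apply/funext => w; rewrite addr0.
have -> : (fun w => (expR (\sum_k Y k w ^+ 2 / 2 + cst 0 w))%:E) =
    fun w => (expR (\sum_k Y k w ^+ 2 / 2))%:E.
  by apply/funext => w; rewrite addr0.
by apply => k; exact: measurable_cst.
Qed.

End Independence.

(** * Merging independent families, and squares of random signs *)

Section SumFamily.
Context {d : measure_display} {T : measurableType d} {R : realType}.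
Context {P : probability T R}.

Definition sum_family (I K : finType) (X : I -> {RV P >-> R})
    (Y : K -> {RV P >-> R}) (x : I + K) : {RV P >-> R} :=
  match x with inl i => X i | inr k => Y k end.

Lemma sigma_of_bigcap (I : finType) (X : I -> {RV P >-> R}) (J : set I)
    (V : I -> set R) : (forall i, measurable (V i)) ->
  sigma_of X (\bigcap_(i in J) (X i @^-1` V i)).
Proof.
move=> mV; set G := \bigcup_(i in [set: I]) preimage_set_system [set: T] (X i) measurable.
rewrite -[sigma_of X]/(@measurable _ (g_sigma_algebraType G)).
apply: fin_bigcap_measurable => // i _; apply: sub_sigma_algebra.
by exists i => //; exists (V i) => //; rewrite setTI.
Qed.

Lemma sigma_of_sum_family (I K : finType) (X : I -> {RV P >-> R})
    (Y : K -> {RV P >-> R}) :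
  sigma_of (sum_family X Y) `<=` <<s sigma_of X `|` sigma_of Y >>.
Proof.
apply: smallest_sub; first exact: smallest_sigma_algebra.
move=> b [[i|k] _ XYb]; apply: sub_sigma_algebra.
- by left; apply: sub_sigma_algebra; exists i.
- by right; apply: sub_sigma_algebra; exists k.
Qed.

(** A cylinder over the sum type is the intersection of a cylinder in [X] and one in [Y]. Its
    probability factors across the two families first, then within each. *)
Lemma sum_family_independent (I K : finType) (X : I -> {RV P >-> R})
    (Y : K -> {RV P >-> R}) :
  mutually_independent X -> mutually_independent Y ->
  independent_systems P (sigma_of X) (sigma_of Y) ->
  mutually_independent (sum_family X Y).
Proof.
move=> iX iY XY J V mV.
pose JX := [set i : I | inl i \in J]%SET.
pose JY := [set k : K | inr k \in J]%SET.
have -> : (\prod_(x in J) P (sum_family X Y x @^-1` V x) =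
    \prod_(i in JX) P (X i @^-1` V (inl i)) *
    \prod_(k in JY) P (Y k @^-1` V (inr k)))%E.
  by rewrite big_sumType/=; congr (_ * _)%E; apply: eq_bigl => x; rewrite inE.
rewrite -(iX _ (V \o inl))//; last by move=> i; exact: mV.
rewrite -(iY _ (V \o inr))//; last by move=> i; exact: mV.
rewrite -XY; [|by apply: sigma_of_bigcap => i; exact: mV..].
congr (P _); apply/seteqP; split=> [w Jw|w [Xw Yw] [i|k] /= xJ].
- by split=> i; rewrite /= inE => iJ; exact: (Jw _ iJ).
- by apply: Xw; rewrite /= inE.
- by apply: Yw; rewrite /= inE.
Qed.

(** The atoms at 1 and -1 already carry the whole mass. *)
Lemma rademacher_sqr (Y : {RV P >-> R}) : rademacher Y ->
  \forall w \ae P, Y w ^+ 2 = 1.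
Proof.
have neqN1 : 1 <> -1 :> R by move=> ?; lra.
move=> [Y1 YN1].
have mY (r : R) : measurable [set w | Y w = r].
  rewrite -[[set w | _]]/(Y @^-1` [set r]); exact: measurable_funPTI.
have PE : P [set w | Y w ^+ 2 = 1] = 1%E.
  rewrite (_ : [set w | _] = [set w | Y w = 1] `|` [set w | Y w = -1]);
    last first.
    apply/seteqP; split => [w /eqP|w]; last first.
      by move=> [] /= ->; rewrite ?sqrrN expr1n.
    by rewrite sqrf_eq1 => /orP[/eqP|/eqP]; [left|right].
  rewrite measureU//; last first.
    by apply/seteqP; split => // w [/= ->].
  by rewrite [X in (X + _)%E]Y1 [X in (_ + X)%E]YN1 -EFinD; congr (_%:E); field.
have mE : measurable [set w | Y w ^+ 2 = 1].
  rewrite -[[set w | _]]/((fun w => Y w ^+ 2) @^-1` [set 1]) -[X in measurable X]setTI.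
  have mY2 : measurable_fun setT (fun w => Y w ^+ 2) by exact: measurable_funX.
  exact: mY2.
exists (~` [set w | Y w ^+ 2 = 1]); split => //; first exact: measurableC.
by rewrite probability_setC// PE subee.
Qed.

End SumFamily.

(** The tangent to [expR] at the mean [c] lies below the graph; averaging over [k] cancels the
    linear terms. *)
Lemma expR_mean_le (R : realType) (K : finType) (x : K -> R) : (0 < #|K|)%N ->
  expR ((\sum_k x k) / #|K|%:R) <= (\sum_k expR (x k)) / #|K|%:R.
Proof.
move=> K0; set c := _ / _.
have K0' : 0 < #|K|%:R :> R by rewrite ltr0n.
rewrite ler_pdivlMr//.
have tangent k : expR c * (1 + (x k - c)) <= expR (x k).
  have -> : expR (x k) = expR c * expR (x k - c) by rewrite -expRD addrC subrK.
  by rewrite ler_pM2l ?expR_gt0// expR_ge1Dx.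
apply: le_trans (ler_sum _ (fun k _ => tangent k)).
rewrite -mulr_sumr ler_pM2l ?expR_gt0// big_split/= sumrB !sumr_const.
by rewrite -[c *+ _]mulr_natr /c divfK ?gt_eqF// subrr addr0.
Qed.

(** * The exponential moments of an entry of the noise matrix *)

Section NoiseMgf.
Context {d : measure_display} {T : measurableType d} {R : realType}.
Context {P : probability T R} {m n : nat}.
Variables (A B : 'I_m * 'I_n -> {RV P >-> R}).
Variable E : 'I_m * 'I_m -> {RV P >-> R}.

Lemma noise_mxE (w : T) (i j : 'I_n) : noise_mx A B E w i j =
  m%:R^-1 * \sum_k A (k, i) w * \sum_l E (k, l) w * B (l, j) w.
Proof.
rewrite /noise_mx mxE -mulmxA mxE; congr (_ * _); apply: eq_bigr => k _.
by rewrite !mxE; congr (_ * _); apply: eq_bigr => l _; rewrite !mxE.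
Qed.

Lemma measurable_noise_mx (i j : 'I_n) :
  measurable_fun [set: T] (fun w => noise_mx A B E w i j).
Proof.
under eq_fun do rewrite noise_mxE.
apply: measurable_funM => //; apply: measurable_sum => k.
apply: measurable_funM => //; apply: measurable_sum => l.
exact: measurable_funM.
Qed.

Hypotheses (m_gt0 : (0 < m)%N).
Hypotheses (nA : forall p, std_normal (A p)) (iA : mutually_independent A).
Hypotheses (nB : forall p, std_normal (B p)) (iB : mutually_independent B).
Hypotheses (rE : forall p, rademacher (E p)) (iE : mutually_independent E).
Hypothesis AB : independent_systems P (sigma_of A) (sigma_of B).
Hypothesis EAB :
  independent_systems P (sigma_of E) <<s sigma_of A `|` sigma_of B >>.

Let X := sum_family (sum_family A B) E.

Let indX : mutually_independent X.
Proof.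
apply: sum_family_independent => //; first exact: sum_family_independent.
move=> a b /sigma_of_sum_family Ga Gb.
by rewrite setIC EAB// muleC.
Qed.

Lemma noise_mgf (i j : 'I_n) (u : R) : u ^+ 2 < 1 ->
  (\int[P]_w (expR (u * noise_mx A B E w i j))%:E <=
   ((Num.sqrt (1 - u ^+ 2))^-1)%:E)%E.
Proof.
move=> u1.
pose a k : ('I_m * 'I_n + 'I_m * 'I_n) + 'I_m * 'I_m := inl (inl (k, i)).
pose b l : ('I_m * 'I_n + 'I_m * 'I_n) + 'I_m * 'I_m := inl (inr (l, j)).
pose e k l : ('I_m * 'I_n + 'I_m * 'I_n) + 'I_m * 'I_m := inr (k, l).
have inja : injective a by move=> k l [].
have injb : injective b by move=> k l [].
have nXa k : std_normal (X (a k)) by exact: nA.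
have nXb l : std_normal (X (b l)) by exact: nB.
have m0 : 0 < m%:R :> R by rewrite ltr0n.
have sm0 : 0 < Num.sqrt m%:R :> R by rewrite sqrtr_gt0.
pose S k w := \sum_l X (e k l) w * X (b l) w.
have mS k l : measurable_fun [set: others_type X (a k)]
    (S l : others_type X (a k) -> R).
  apply: measurable_sum => p; apply: measurable_funM; exact: measurable_others.
have mST k : measurable_fun [set: T] (S k).
  by apply: measurable_sum => p; exact: measurable_funM.
have expand w : u * noise_mx A B E w i j = \sum_k X (a k) w * (u / m%:R * S k w).
  rewrite noise_mxE mulrA mulr_sumr; apply: eq_bigr => k _.
  by rewrite mulrCA.
under eq_integral do rewrite expand.
rewrite (gaussian_elim_sum indX inja)//; last first.
  by move=> k l; exact: measurable_funM.
(* Eliminating column [i] of [A] leaves squares carrying [(u / m)^2]. With only [1 / sqrt m] inside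
   [g k], the exponent is the average over [k] of the [g k ^+ 2 / 2]. *)
pose g k w := u / Num.sqrt m%:R * S k w.
have mg k : measurable_fun [set: T] (g k) by exact: measurable_funM.
have one k : (\int[P]_w (expR (g k w ^+ 2 / 2))%:E =
    ((Num.sqrt (1 - u ^+ 2))^-1)%:E)%E.
  (* [gaussian_elim] is read backwards: the entry [A (k, i)], absent from [g k], linearises the
     square. The exponent is then linear in column [j] of [B], which is integrated out in turn. *)
  transitivity (\int[P]_w (expR (X (a k) w * g k w + 0))%:E)%E.
    rewrite (gaussian_elim indX (i := a k) (Y := g k) (Z := cst 0))//.
    - by apply: eq_integral => w _; rewrite addr0.
    - exact: measurable_funM.
  transitivity (\int[P]_w (expR (\sum_l X (b l) w *
      (u / Num.sqrt m%:R * X (a k) w * X (e k l) w)))%:E)%E.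
    apply: eq_integral => w _; congr (expR _)%:E.
    rewrite addr0 /g /S !mulr_sumr; apply: eq_bigr => l _.
    by ring.
  rewrite (gaussian_elim_sum (Y := fun l w =>
      u / Num.sqrt m%:R * X (a k) w * X (e k l) w) indX injb nXb); last first.
    move=> p l; apply: measurable_funM; last exact: measurable_others.
    by apply: measurable_funM; [exact: measurable_cst|exact: measurable_others].
  (* Almost surely all signs square to 1, so the [m] terms left by [B] are equal and cancel the
     factor [1 / m]. *)
  transitivity (\int[P]_w (expR (u ^+ 2 * (A (k, i) w ^+ 2 / 2)))%:E)%E.
    apply: ae_eq_integral => //.
    - apply/measurable_EFinP; apply: measurableT_comp => //.
      apply: measurable_sum => l; apply: measurable_funM => //.
      by apply: measurable_funX; do 2 apply: measurable_funM => //.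
    - apply/measurable_EFinP; apply: measurableT_comp => //.
      by apply: measurable_funM => //; apply: measurable_funM => //; exact: measurable_funX.
    have : \forall w \ae P, forall l, E (k, l) w ^+ 2 = 1.
      by apply: filter_forall => l; exact: rademacher_sqr.
    apply: filterS => w E1 _; congr (expR _)%:E.
    transitivity (\sum_(l < m) u ^+ 2 * (A (k, i) w ^+ 2 / 2) / m%:R).
      apply: eq_bigr => l _; rewrite !exprMn [X (e k l) w]/(E (k, l) w) E1.
      by rewrite exprVn sqr_sqrtr ?ltW//; field; rewrite gt_eqF.
    by rewrite sumr_const card_ord -[_ *+ m]mulr_natr divfK// gt_eqF.
  transitivity (\int[distribution P (A (k, i))]_x
      (expR (u ^+ 2 * (x ^+ 2 / 2)))%:E)%E.
    rewrite ge0_integral_distribution//.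
    apply/measurable_EFinP; apply: measurableT_comp => //.
    by apply: measurable_funM => //; apply: measurable_funM => //; exact: measurable_funX.
  rewrite integral_std_normal//; first exact: normal_sqr_mgf.
  apply/measurable_EFinP; apply: measurableT_comp => //.
  by apply: measurable_funM => //; apply: measurable_funM => //; exact: measurable_funX.
have mexp k : measurable_fun [set: T] (fun w => expR (g k w ^+ 2 / 2)).
  apply: measurableT_comp => //; apply: measurable_funM => //.
  exact: measurable_funX.
apply: (@le_trans _ _
    (\int[P]_w (m%:R^-1%:E * \sum_k (expR (g k w ^+ 2 / 2))%:E)))%E.
  apply: ge0_le_integral => //.
  - apply/measurable_EFinP; apply: measurableT_comp => //.
    apply: measurable_sum => k; apply: measurable_funM => //.
    by apply: measurable_funX; exact: measurable_funM.
  - apply: emeasurable_funM => //; apply: emeasurable_sum => k.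
    exact/measurable_EFinP.
  move=> w _; rewrite sumEFin -EFinM lee_fin.
  have := @expR_mean_le R 'I_m (fun k => g k w ^+ 2 / 2).
  rewrite card_ord => /(_ m_gt0); rewrite [in leRHS]mulrC.
  apply: le_trans; rewrite ler_expR mulr_suml; apply: ler_sum => k _.
  rewrite /g !exprMn !exprVn sqr_sqrtr ?(ltW m0)// le_eqVlt; apply/orP; left.
  by apply/eqP; field; rewrite gt_eqF.
rewrite ge0_integralZl//.
- rewrite ge0_integral_sum//; last first.
    by move=> k; exact/measurable_EFinP.
  under eq_bigr do rewrite one.
  rewrite sumEFin sumr_const card_ord -EFinM lee_fin mulrnAr -mulrnAl.
  by rewrite -[m%:R^-1 *+ m]mulr_natr mulVf ?mul1r// gt_eqF.
- by apply: emeasurable_sum => k; exact/measurable_EFinP.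
- by move=> w _; apply: sume_ge0 => k _; rewrite lee_fin expR_ge0.
Qed.

End NoiseMgf.

(** * Elementary inequalities for the exponential and the inverse square root *)

Section ExponentialInequalities.
Context {R : realType}.
Implicit Types x v : R.

Lemma expR_ge_quadratic x : 0 <= x -> 1 + x + x ^+ 2 / 2 <= expR x.
Proof.
move=> x0.
have nd : nondecreasing_seq (series (exp_coeff x)).
  by apply: nondecreasing_series => k _ _; exact: exp_coeff_ge0.
have := nondecreasing_cvgn_le nd (is_cvg_series_exp_coeff x) 3.
apply: le_trans; rewrite /series/= !big_nat_recr//= big_geq// /exp_coeff/=.
by rewrite !factS fact0 !muln1 add0r expr0 expr1 !divr1.
Qed.

(** With [y = x / 2], the difference [expR x + expR (- x) - 2] is the square of [a - b], and
    [a - b >= 2 y] for [y >= 0]. *)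
Lemma cosh_ge_quadratic x : 2 + x ^+ 2 <= expR x + expR (- x).
Proof.
wlog x0 : x / 0 <= x => [hw|].
  have [/hw//|/ltW x0] := leP 0 x.
  by have := hw (- x); rewrite oppr_ge0 opprK sqrrN (addrC (expR (- x))); exact.
pose y := x / 2; pose a := expR y; pose b := expR (- y).
have y0 : 0 <= y by rewrite divr_ge0.
have ab : a * b = 1 by exact: expRxMexpNx_1.
have b0 : 0 <= b by exact: expR_ge0.
have ha : 1 + y + y ^+ 2 / 2 <= a by exact: expR_ge_quadratic.
(* [b] is the inverse of [a], and [(1 + y + y^2 / 2) (1 - y + y^2 / 2) = 1 + y^4 / 4 >= 1]. *)
have hb : b <= 1 - y + y ^+ 2 / 2.
  have c0 : 0 < 1 + y + y ^+ 2 / 2 by nra.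
  rewrite -(ler_pM2l c0).
  apply: (@le_trans _ _ (a * b)); first by rewrite ler_wpM2r.
  by rewrite ab; have := sqr_ge0 (y ^+ 2); nra.
have hs : 2 * y <= a - b by lra.
have -> : expR x = a ^+ 2 by rewrite expr2 -expRD; congr expR; rewrite /y; field.
have -> : expR (- x) = b ^+ 2 by rewrite expr2 -expRD; congr expR; rewrite /y; field.
have -> : x = 2 * y by rewrite /y; field.
have : (2 * y) ^+ 2 <= (a - b) ^+ 2.
  by rewrite lerXn2r// ?nnegrE ?(le_trans _ hs) ?mulr_ge0.
by rewrite sqrrB ab; lra.
Qed.

(** After squaring, the claim is [(1 - v) (1 + v / 2 + v^2)^2 >= 1]. In the expansion, [5/4 v^2]
    dominates the negative terms because [v^3] and [v^5] are at most [v^2 / 2]. *)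
Lemma invr_sqrt_le v : 0 <= v <= 2^-1 ->
  (Num.sqrt (1 - v))^-1 <= 1 + v / 2 + v ^+ 2.
Proof.
move=> /andP[v0 v2].
have w0 : 0 < 1 - v by lra.
have q0 : 0 < 1 + v / 2 + v ^+ 2 by nra.
rewrite -[leRHS]invrK lef_pV2 ?posrE ?invr_gt0 ?sqrtr_gt0//.
rewrite -[leLHS]ger0_norm; last by rewrite invr_ge0 ltW.
rewrite -sqrtr_sqr ler_wsqrtr//.
rewrite exprVn -[leLHS]mul1r ler_pdivrMr ?exprn_gt0//.
have v3 : v ^+ 3 <= v ^+ 2 / 2 by rewrite exprS mulrC ler_wpM2l ?sqr_ge0.
have v5 : v ^+ 5 <= v ^+ 2 / 2.
  rewrite (_ : v ^+ 5 = v ^+ 2 * v ^+ 3); last by ring.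
  rewrite ler_wpM2l ?sqr_ge0// (le_trans v3)//.
  nra.
have -> : (1 - v) * (1 + v / 2 + v ^+ 2) ^+ 2 =
  1 + 5 / 4 * v ^+ 2 - 5 / 4 * v ^+ 3 - v ^+ 5 by field.
by have := sqr_ge0 v; lra.
Qed.

(** With [z = 4/5 (|x| - v) >= 0], the bound [z^2 / 2 <= expR z] gives the factor
    [2 (5/4)^2 = 25 / 8]. The two exponentials on the right cover both signs of [x]. *)
Lemma sqr_pos_part_le x v : 0 < v ->
  Num.max (`|x| - v) 0 ^+ 2 <=
  25 / 8 * expR (- (4 / 5 * v)) * (expR (4 / 5 * x) + expR (- (4 / 5) * x)).
Proof.
move=> v0.
have rhs0 : 0 <= 25 / 8 * expR (- (4 / 5 * v)) *
    (expR (4 / 5 * x) + expR (- (4 / 5) * x)).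
  by rewrite !mulr_ge0 ?addr_ge0 ?expR_ge0//.
have [xv|xv] := leP (`|x| - v) 0; first by rewrite expr0n.
have h : 4 / 5 * (`|x| - v) >= 0 by rewrite mulr_ge0// ltW.
have /le_trans : (`|x| - v) ^+ 2 <= 25 / 8 * expR (4 / 5 * (`|x| - v)).
  by have := expR_ge_quadratic h; nra.
apply; rewrite -[leRHS]mulrA ler_pM2l//.
have -> : 4 / 5 * (`|x| - v) = - (4 / 5 * v) + 4 / 5 * `|x| by ring.
rewrite expRD ler_pM2l ?expR_gt0//.
have [_|_] := ger0P x; first by rewrite lerDl expR_ge0.
by rewrite mulrN mulNr lerDr expR_ge0.
Qed.

End ExponentialInequalities.

(** * Moments deduced from the bound on the exponential moments alone *)

Section MgfMoments.
Context {d : measure_display} {T : measurableType d} {R : realType}.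
Context {P : probability T R}.
Variable Y : T -> R.
Hypothesis mY : measurable_fun [set: T] Y.
Hypothesis mgfY : forall u, u ^+ 2 < 1 ->
  (\int[P]_w (expR (u * Y w))%:E <= ((Num.sqrt (1 - u ^+ 2))^-1)%:E)%E.

Let mexp u : measurable_fun [set: T] (fun w => (expR (u * Y w))%:E).
Proof.
by apply/measurable_EFinP; apply: measurableT_comp => //; exact: measurable_funM.
Qed.

Let msqr : measurable_fun [set: T] (fun w => (Y w ^+ 2)%:E).
Proof. by apply/measurable_EFinP; exact: measurable_funX. Qed.

Let mgfY_small u : u ^+ 2 <= 2^-1 ->
  (\int[P]_w (expR (u * Y w))%:E <= (1 + u ^+ 2 / 2 + u ^+ 4)%:E)%E.
Proof.
move=> u2; apply: le_trans (mgfY _) _; first by lra.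
rewrite lee_fin (_ : u ^+ 4 = (u ^+ 2) ^+ 2); last by ring.
by apply: invr_sqrt_le; rewrite sqr_ge0.
Qed.

Lemma mgf_second_moment : (\int[P]_w (Y w ^+ 2)%:E <= 1)%E.
Proof.
apply/lee_addgt0Pr => e e0.
(* For [u^2 = v], [cosh_ge_quadratic] gives [2 + v E Y^2 <= 2 (1 + v / 2 + v^2)], that is
   [E Y^2 <= 1 + 2 v]; the second bound on [v] makes [2 v <= e]. *)
pose v := Num.min 2^-1 (e / 2).
have v0 : 0 < v by rewrite lt_min invr_gt0 ltr0n divr_gt0.
have v1 : v <= 2^-1 by rewrite ge_min lexx.
have v2 : v <= e / 2 by rewrite ge_min lexx orbT.
pose u := Num.sqrt v.
have u2 : u ^+ 2 = v by rewrite sqr_sqrtr// ltW.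
have H : (2%:E + v%:E * \int[P]_w (Y w ^+ 2)%:E <= (2 * (1 + v / 2 + v ^+ 2))%:E)%E.
  have -> : (2%:E + v%:E * \int[P]_w (Y w ^+ 2)%:E =
             \int[P]_w (2%:E + v%:E * (Y w ^+ 2)%:E))%E.
    rewrite ge0_integralD//; last 2 first.
    - by move=> w _; rewrite mule_ge0 ?lee_fin ?sqr_ge0// ltW.
    - exact: emeasurable_funM.
    rewrite integral_cst//= probability_setT mule1 ge0_integralZl//.
    - by move=> w _; rewrite lee_fin sqr_ge0.
    - by rewrite lee_fin ltW.
  apply: (@le_trans _ _ (\int[P]_w ((expR (u * Y w))%:E + (expR (- u * Y w))%:E)))%E.
    apply: ge0_le_integral => //.
    - move=> w _; rewrite adde_ge0// mule_ge0// lee_fin ?sqr_ge0//.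
      exact: ltW.
    - by apply: emeasurable_funD => //; exact: emeasurable_funM.
    - exact: emeasurable_funD.
    - move=> w _; rewrite -EFinM -!EFinD lee_fin mulNr -u2 -exprMn.
      exact: cosh_ge_quadratic.
  rewrite ge0_integralD//.
  apply: le_trans (leeD (mgfY_small _) (mgfY_small _)) _; rewrite ?sqrrN ?u2//.
  rewrite -EFinD lee_fin (_ : (- u) ^+ 4 = v ^+ 2); last by rewrite -u2; ring.
  rewrite (_ : u ^+ 4 = v ^+ 2); last by rewrite -u2; ring.
  by lra.
have I0 : (0 <= \int[P]_w (Y w ^+ 2)%:E)%E.
  by apply: integral_ge0 => w _; rewrite lee_fin sqr_ge0.
move: (\int[P]_w (Y w ^+ 2)%:E)%E I0 H => [r| |]//.
- by rewrite -EFinM -!EFinD !lee_fin => r0 H; nra.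
- by rewrite gt0_muley ?lte_fin.
Qed.

Lemma mgf_integrable_sqr : P.-integrable [set: T] (fun w => (Y w ^+ 2)%:E).
Proof.
apply/integrableP; split => //.
under eq_integral do rewrite gee0_abs ?lee_fin ?sqr_ge0//.
by apply: le_lt_trans mgf_second_moment _; rewrite ltry.
Qed.

Let integrable_const (c : R) : P.-integrable [set: T] (fun=> c%:E).
Proof. exact: finite_measure_integrable_cst. Qed.

Lemma mgf_integrable : P.-integrable [set: T] (fun w => (Y w)%:E).
Proof.
apply: (@le_integrable _ _ _ _ _ _ _ (fun w => 1%:E + (Y w ^+ 2)%:E)%E) => //.
- exact/measurable_EFinP.
- move=> w _; rewrite -EFinD !abse_EFin lee_fin.
  rewrite [leRHS]ger0_norm ?addr_ge0 ?sqr_ge0//.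
  rewrite -[Y w ^+ 2]real_normK ?num_real//.
  by have := sqr_ge0 (`|Y w| - 1); have := normr_ge0 (Y w); nra.
- by apply: integrableD => //; exact: mgf_integrable_sqr.
Qed.

(** From [1 + u Y <= expR (u Y)] the mean [r] satisfies [u r <= u^2 / 2 + u^4] for small [u] of
    either sign; dividing by [|u|] and letting [u] tend to 0 forces [r = 0]. *)
Lemma mgf_mean0 : (\int[P]_w (Y w)%:E = 0)%E.
Proof.
have intY := mgf_integrable.
have := integrable_fin_num measurableT intY.
set I := (\int[P]_w (Y w)%:E)%E => /fineK <-; set r := fine I.
have H u : u ^+ 2 <= 2^-1 -> u * r <= u ^+ 2 / 2 + u ^+ 4.
  move=> u2.
  have : (1%:E + u%:E * I <= (1 + u ^+ 2 / 2 + u ^+ 4)%:E)%E.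
    apply: le_trans (mgfY_small u2).
    have -> : (1%:E + u%:E * I = \int[P]_w (1%:E + u%:E * (Y w)%:E))%E.
      rewrite integralD//; last exact: integrableZl.
      by rewrite integral_cst//= probability_setT mule1 integralZl.
    apply: le_integral => //.
    - by apply: integrableD => //; exact: integrableZl.
    - apply/integrableP; split => //.
      under eq_integral do rewrite gee0_abs ?lee_fin ?expR_ge0//.
      by apply: le_lt_trans (mgfY_small u2) _; rewrite ltry.
    - by move=> w _; rewrite -EFinM -EFinD lee_fin expR_ge1Dx.
  rewrite -[I]fineK; last exact: integrable_fin_num.
  by rewrite -EFinM -EFinD lee_fin -/r; lra.
congr (_%:E); apply/eqP; rewrite -normr_le0; apply/ler_addgt0Pl => e e0; rewrite addr0.
pose u := Num.min 2^-1 e.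
have u0 : 0 < u by rewrite lt_min invr_gt0 ltr0n.
have u1 : u <= 2^-1 by rewrite ge_min lexx.
have ue : u <= e by rewrite ge_min lexx orbT.
have u2 : u ^+ 2 <= 2^-1 by nra.
have u4 : u ^+ 4 <= u ^+ 2 / 2.
  by rewrite (_ : u ^+ 4 = u ^+ 2 * u ^+ 2) ?ler_wpM2l ?sqr_ge0//; ring.
apply: le_trans ue; rewrite ler_norml; apply/andP; split.
- rewrite -(ler_pM2l u0).
  have := H (- u); rewrite sqrrN (_ : (- u) ^+ 4 = u ^+ 4); last by ring.
  by move=> /(_ u2); lra.
- by rewrite -(ler_pM2l u0); have := H u u2; lra.
Qed.

Lemma mgf_shifted_moment (a : R) :
  (\int[P]_w ((Y w - a) ^+ 2)%:E <= (1 + a ^+ 2)%:E)%E.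
Proof.
have -> : (\int[P]_w ((Y w - a) ^+ 2)%:E =
    \int[P]_w ((Y w ^+ 2)%:E + (a ^+ 2)%:E + (- a *+ 2)%:E * (Y w)%:E))%E.
  by apply: eq_integral => w _; rewrite -EFinM -!EFinD; congr (_%:E); ring.
have intY := mgf_integrable; have intY2 := mgf_integrable_sqr.
rewrite integralD//; [|exact: integrableD|exact: integrableZl].
rewrite integralZl// mgf_mean0 mule0 adde0 integralD//.
rewrite integral_cst//= probability_setT mule1 EFinD.
by rewrite leeD2r// mgf_second_moment.
Qed.

(** The choice [u = 4/5] makes [sqrt (1 - u^2) = 3/5] rational. Each exponential has mean at most
    [5/3], and [25/8 * 10/3 = 125/12]. *)
Lemma mgf_tail_moment (t : R) : 0 < t ->
  (\int[P]_w (Num.max (`|Y w| - t) 0 ^+ 2)%:E <=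
   (125 / 12 * expR (- (4 / 5 * t)))%:E)%E.
Proof.
move=> t0; set K := 25 / 8 * expR (- (4 / 5 * t)).
have K0 : 0 <= K by rewrite mulr_ge0 ?expR_ge0.
apply: (@le_trans _ _ (\int[P]_w
    (K%:E * ((expR (4 / 5 * Y w))%:E + (expR (- (4 / 5) * Y w))%:E)))%E).
  apply: ge0_le_integral => //.
  - by move=> w _; rewrite lee_fin sqr_ge0.
  - apply/measurable_EFinP; apply: measurable_funX.
    apply: measurable_maxr => //; apply: measurable_funB => //.
    exact: measurableT_comp.
  - by apply: emeasurable_funM => //; exact: emeasurable_funD.
  - by move=> w _; rewrite -EFinD -EFinM lee_fin; exact: sqr_pos_part_le.
rewrite ge0_integralZl//; last 2 first.
- exact: emeasurable_funD.
- by move=> w _; rewrite -EFinD lee_fin addr_ge0 ?expR_ge0.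
rewrite ge0_integralD//.
have s : Num.sqrt (1 - (4 / 5) ^+ 2) = 3 / 5 :> R.
  rewrite (_ : 1 - _ = (3 / 5) ^+ 2); last by field.
  by rewrite sqrtr_sqr ger0_norm.
have le1 u : u ^+ 2 = (4 / 5) ^+ 2 -> (\int[P]_w (expR (u * Y w))%:E <= (5 / 3)%:E)%E.
  move=> uE; apply: le_trans (mgfY _) _; rewrite uE ?s; first by lra.
  by rewrite lee_fin invf_div.
apply: (@le_trans _ _ (K%:E * ((5 / 3)%:E + (5 / 3)%:E)))%E.
  by apply: lee_wpmul2l; [rewrite lee_fin|apply: leeD; apply: le1; rewrite ?sqrrN].
by rewrite -EFinD -EFinM lee_fin /K; lra.
Qed.

End MgfMoments.

(** * Deterministic bound for products with the unit vectors of the descent cone *)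

Section DescentCone.
Context {R : realType}.

(* The squared distance from [h] to [t] times the subdifferential of the
   absolute value at [x] if [b], and to [0] otherwise. *)
Definition sqr_gap (t : R) (b : bool) (x h : R) : R :=
  if ~~ b then h ^+ 2
  else if x != 0 then (h - t * Num.sg x) ^+ 2
  else Num.max (`|h| - t) 0 ^+ 2.

Lemma sqr_gap_ge0 (t : R) b (x h : R) : 0 <= sqr_gap t b x h.
Proof. by rewrite /sqr_gap; case: ifP => _; [|case: ifP => _]; rewrite sqr_ge0. Qed.

(** If [b], subtract from [h] the nearest [t] times a subgradient at [x]. The subgradient inequality
    for the step [e u] bounds the removed part, and the inequality of means with weight [K] bounds
    the residual. This keeps the estimate linear in [sqr_gap], ready for expectation. *)
Lemma sqr_gap_bound (K t e x h u : R) b : 0 < K -> 0 < e -> 0 <= t ->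
  h * u <= (sqr_gap t b x h / K + K * u ^+ 2) / 2 +
           (if b then t / e * (`|x + e * u| - `|x|) else 0).
Proof.
move=> K0 e0 t0.
have amgm (a v : R) : a * v <= (a ^+ 2 / K + K * v ^+ 2) / 2.
  have -> : (a ^+ 2 / K + K * v ^+ 2) / 2 = (a ^+ 2 + (K * v) ^+ 2) / (2 * K).
    by field; rewrite gt_eqF.
  rewrite ler_pdivlMr ?mulr_gt0//.
  by have := sqr_ge0 (a - K * v); lra.
rewrite /sqr_gap; case: b => /=; last by rewrite addr0.
have [->|x0] := eqVneq x 0; rewrite /=.
  rewrite add0r normr0 subr0 (normrM e) (gtr0_norm e0).
  have -> : t / e * (e * `|u|) = t * `|u| by field; rewrite gt_eqF.
  set M := Num.max _ _.
  have M1 : `|h| - t <= M by rewrite le_max lexx.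
  have -> : u ^+ 2 = `|u| ^+ 2 by rewrite real_normK ?num_real.
  have := amgm M `|u|; have := normr_ge0 u.
  have : h * u <= `|h| * `|u| by rewrite -normrM ler_norm.
  by nra.
have sub : Num.sg x * (e * u) <= `|x + e * u| - `|x|.
  have : Num.sg x * (x + e * u) <= `|x + e * u|.
    rewrite (le_trans (ler_norm _))// normrM normr_sg x0 mul1r.
    exact: lexx.
  by rewrite mulrDr -normrEsg; lra.
have := ler_wpM2l (divr_ge0 t0 (ltW e0)) sub.
have -> : t / e * (Num.sg x * (e * u)) = t * Num.sg x * u.
  by field; rewrite gt_eqF.
by have := amgm (h - t * Num.sg x) u; lra.
Qed.

Lemma frobenius_dotE (n : nat) (H U : 'M[R]_n) :
  frobenius_dot H U = \sum_j \sum_i H i j * U i j.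
Proof.
rewrite /frobenius_dot /mxtrace; apply: eq_bigr => j _; rewrite mxE.
by apply: eq_bigr => i _; rewrite mxE.
Qed.

Lemma frobenius_norm1 (n : nat) (U : 'M[R]_n) : frobenius_norm U = 1 ->
  \sum_j \sum_i U i j ^+ 2 = 1.
Proof.
move=> U1.
have -> : \sum_j \sum_i U i j ^+ 2 = frobenius_dot U U.
  by rewrite frobenius_dotE; apply: eq_bigr => j _; apply: eq_bigr => i _.
have D0 : 0 <= frobenius_dot U U.
  rewrite frobenius_dotE; apply: sumr_ge0 => j _; apply: sumr_ge0 => i _.
  by rewrite -expr2 sqr_ge0.
by rewrite -(sqr_sqrtr D0) [Num.sqrt _]U1 expr1n.
Qed.

Lemma l1norm_col_le (n : nat) (Z : 'M[R]_n) (j : 'I_n) :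
  l1norm (col j Z) <= max_col_l1norm Z.
Proof. exact: (le_bigmax _ (fun k => l1norm (col k Z))). Qed.

(** The default value 0 of the maximum lies below every l1 norm, so some column attains the maximum
    once there is one. *)
Lemma max_cols_gt0 (n : nat) (X : 'M[R]_n) : (0 < n)%N -> (0 < #|max_cols X|)%N.
Proof.
case: n X => // n X _; apply/card_gt0P.
have [j _ jE] := @eq_bigmax _ _ _ 0 ord0 xpredT (fun k => l1norm (col k X)) isT
  (fun k _ => sumr_ge0 _ (fun i _ => normr_ge0 _)).
by exists j; rewrite inE /max_col_l1norm jE.
Qed.

Lemma Gamma_dot_le (n : nat) (X H U : 'M[R]_n) (K t : R) : 0 < K -> 0 <= t ->
  Gamma X U -> frobenius_norm U = 1 ->
  frobenius_dot H U <=
  ((\sum_j \sum_i sqr_gap t (j \in max_cols X) (X i j) (H i j)) / K + K) / 2.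
Proof.
move=> K0 t0 [e e0 XU] U1; rewrite frobenius_dotE.
pose D j i := `|X i j + e * U i j| - `|X i j|.
(* A column of [X] that is already maximal cannot grow along [e *: U], since its new norm is at most
   that of the whole matrix, which does not exceed [max_col_l1norm X]. *)
have D0 j : j \in max_cols X -> \sum_i D j i <= 0.
  rewrite inE => /eqP jX; rewrite sumrB subr_le0.
  have <- : l1norm (col j (X + e *: U)) = \sum_i `|X i j + e * U i j|.
    by apply: eq_bigr => i _; rewrite !mxE.
  have <- : l1norm (col j X) = \sum_i `|X i j|.
    by apply: eq_bigr => i _; rewrite !mxE.
  by rewrite jX; exact: le_trans (l1norm_col_le _ _) XU.
apply: (@le_trans _ _ (\sum_j \sum_i
  ((sqr_gap t (j \in max_cols X) (X i j) (H i j) / K + K * U i j ^+ 2) / 2 +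
   (if j \in max_cols X then t / e * D j i else 0)))).
  by apply: ler_sum => j _; apply: ler_sum => i _; exact: sqr_gap_bound.
apply: (@le_trans _ _ (\sum_j \sum_i
  ((sqr_gap t (j \in max_cols X) (X i j) (H i j) / K + K * U i j ^+ 2) / 2))).
  apply: ler_sum => j _; rewrite big_split/= gerDl.
  have [jX|jX] := boolP (j \in max_cols X); last by rewrite big1.
  by rewrite -mulr_sumr mulr_ge0_le0 ?D0// divr_ge0// ltW.
rewrite le_eqVlt; apply/orP; left; apply/eqP.
under eq_bigr do rewrite -mulr_suml big_split/= -mulr_suml -mulr_sumr.
by rewrite -mulr_suml big_split/= -mulr_suml -mulr_sumr (frobenius_norm1 U1) mulr1.
Qed.

End DescentCone.

(** The integral is a difference of suprema over simple functions below the positive and negative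
    parts, and each supremum is monotone. This form applies directly to the supremum inside
    [width]. *)
Lemma le_integral_pointwise (d : measure_display) (T : measurableType d)
    (R : realType) (mu : {measure set T -> \bar R}) (f g : T -> \bar R) :
  (forall x, f x <= g x)%E -> (\int[mu]_x f x <= \int[mu]_x g x)%E.
Proof.
move=> fg; rewrite /integral !patch_setT; apply: leeB.
- apply: ereal_sup_le => _ [h hf <-]; exists h => // x.
  apply: le_trans (hf x) _; rewrite !funeposE.
  by rewrite ge_max !le_max fg/= lexx orbT.
- apply: ereal_sup_le => _ [h hg <-]; exists h => // x.
  apply: le_trans (hg x) _; rewrite !funenegE.
  by rewrite ge_max !le_max leeN2 fg/= lexx orbT.
Qed.

(** * Expected squared distance and choice of the threshold *)

Section ExpectedGap.
Context {R : realType}.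

(** Upper bounds for the mean of [sqr_gap], one per case, from the second, the shifted and the tail
    moments. *)
Definition sqr_gap_mean (t : R) (b : bool) (x : R) : R :=
  if ~~ b then 1 else if x != 0 then 1 + t ^+ 2
  else 125 / 12 * expR (- (4 / 5 * t)).

Lemma measurable_sqr_gap (d : measure_display) (T : measurableType d)
    (Y : T -> R) (t : R) b (x : R) : measurable_fun [set: T] Y ->
  measurable_fun [set: T] (fun w => sqr_gap t b x (Y w)).
Proof.
move=> mY; rewrite /sqr_gap; case: b => /=; last exact: measurable_funX.
case: (x != 0); apply: measurable_funX; first exact: measurable_funB.
apply: measurable_maxr => //; apply: measurable_funB => //.
exact: measurableT_comp.
Qed.

Lemma sqr_gap_mean_ge (d : measure_display) (T : measurableType d)
    (P : probability T R) (Y : T -> R) (t : R) b (x : R) :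
  measurable_fun [set: T] Y ->
  (forall u, u ^+ 2 < 1 ->
    (\int[P]_w (expR (u * Y w))%:E <= ((Num.sqrt (1 - u ^+ 2))^-1)%:E)%E) ->
  0 < t ->
  (\int[P]_w (sqr_gap t b x (Y w))%:E <= (sqr_gap_mean t b x)%:E)%E.
Proof.
move=> mY mgf t0; rewrite /sqr_gap /sqr_gap_mean; case: b => /=; last first.
  exact: mgf_second_moment.
have [_|x0] := eqVneq x 0; first exact: mgf_tail_moment.
apply: le_trans (mgf_shifted_moment mY mgf _) _.
by rewrite exprMn sqr_sg x0 mulr1.
Qed.

Lemma sum_sqr_gap_mean_le (n s : nat) (X : 'M[R]_n) (t : R) :
  (forall j : 'I_n, sparse s (col j X)) ->
  \sum_j \sum_i sqr_gap_mean t (j \in max_cols X) (X i j) <=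
  n%:R ^+ 2 + #|max_cols X|%:R *
    (s%:R * (1 + t ^+ 2) + n%:R * (125 / 12 * expR (- (4 / 5 * t))) - n%:R).
Proof.
move=> Xs; set e := 125 / 12 * _; set S := _ - n%:R.
have e0 : 0 <= e by rewrite mulr_ge0 ?expR_ge0.
apply: (@le_trans _ _ (\sum_(j < n) (n%:R + if j \in max_cols X then S else 0))).
  apply: ler_sum => j _; rewrite /sqr_gap_mean; case: ifPn => jX /=; last first.
    by rewrite sumr_const card_ord addr0.
  rewrite [leRHS]addrC /S subrK.
  (* The tail bound is charged to all [n] entries of the column, so that sparsity is used only to
     count the terms [1 + t ^+ 2]. *)
  apply: (@le_trans _ _ (\sum_(i < n) ((if X i j != 0 then 1 + t ^+ 2 else 0) + e))).
    apply: ler_sum => i _; case: ifPn => _; last by rewrite add0r.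
    by rewrite lerDl.
  rewrite big_split/= -big_mkcond/= !sumr_const card_ord.
  rewrite -[e *+ n]mulr_natl lerD2r -[(1 + _) *+ _]mulr_natl.
  rewrite ler_wpM2r ?addr_ge0 ?sqr_ge0// ler_nat.
  apply: leq_trans (Xs j); rewrite cardE cardsE -cardE.
  by apply: subset_leq_card; apply/fintype.subsetP => i; rewrite !unfold_in mxE.
rewrite big_split/= -big_mkcond/= !sumr_const card_ord.
by rewrite -[n%:R *+ n]mulr_natl -expr2 -[S *+ _]mulr_natl.
Qed.

Lemma threshold_log (n r : nat) : (0 < r <= n)%N ->
  let t := ln (expR 10 * n%:R ^+ 2 * r%:R) - 1 : R in
  0 < t /\ n%:R * r%:R * (125 / 12 * expR (- (4 / 5 * t))) <= 1.
Proof.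
move=> /andP[r0 rn]; have n0 : (0 < n)%N by exact: leq_trans rn.
pose a : R := ln n%:R; pose b : R := ln r%:R.
have nR : 0 < n%:R :> R by rewrite ltr0n.
have rR : 0 < r%:R :> R by rewrite ltr0n.
have nE : n%:R = expR a by rewrite lnK.
have rE : r%:R = expR b by rewrite lnK.
have b0 : 0 <= b by apply: ln_ge0; rewrite ler1n.
have ba : b <= a by rewrite /b /a ler_ln ?posrE ?ler_nat.
have -> : ln (expR 10 * n%:R ^+ 2 * r%:R) = 10 + 2 * a + b.
  by rewrite nE rE -expRM_natl -!expRD expRK.
split; first by lra.
rewrite nE rE mulrCA -!expRD.
(* Here [t = 9 + 2 a + b], and the exponent [a + b - 4/5 t] equals [- 36/5 - 3/5 a + 1/5 b], at most
   [- 36/5] because [0 <= b <= a]. *)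
apply: (@le_trans _ _ (125 / 12 * expR (- (36 / 5)))).
  by rewrite ler_pM2l// ler_expR; lra.
rewrite expRN ler_pdivrMr ?expR_gt0// mul1r.
have h : 0 <= 36 / 5 :> R by [].
by have := expR_ge_quadratic h; lra.
Qed.

End ExpectedGap.

(** * From the moments of the noise to the width *)

Section WidthBound.
Context {d : measure_display} {T : measurableType d} {R : realType}.
Context {P : probability T R} {m n : nat}.
Variables (A B : 'I_m * 'I_n -> {RV P >-> R}).
Variable E : 'I_m * 'I_m -> {RV P >-> R}.
Hypothesis mgf : forall (i j : 'I_n) (u : R), u ^+ 2 < 1 ->
  (\int[P]_w (expR (u * noise_mx A B E w i j))%:E <=
   ((Num.sqrt (1 - u ^+ 2))^-1)%:E)%E.

(** All entries of the noise have mean zero. A single direction of the cone then shows that the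
    width is nonnegative, which squaring an upper bound requires. *)
Lemma frobenius_dot_mean0 (U : 'M[R]_n) :
  (\int[P]_w (frobenius_dot (noise_mx A B E w) U)%:E = 0)%E.
Proof.
have intN i j : P.-integrable [set: T] (fun w => (noise_mx A B E w i j)%:E).
  by apply: mgf_integrable; [exact: measurable_noise_mx|exact: mgf].
under eq_integral.
  move=> w _; rewrite frobenius_dotE pair_big/= -sumEFin.
  under eq_bigr do rewrite mulrC EFinM.
  over.
rewrite integral_sum//; last by move=> p; exact: integrableZl.
rewrite big1// => p _; rewrite integralZl// mgf_mean0 ?mule0//.
- exact: measurable_noise_mx.
- exact: mgf.
Qed.

(** The supremum is at most [(Q / K + K) / 2] pointwise, and [E Q <= K^2] turns the mean of this
    into [K]. *)
Lemma width_Gamma_bounds (X : 'M[R]_n) (K t : R) : 0 < K -> 0 < t ->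
  \sum_j \sum_i sqr_gap_mean t (j \in max_cols X) (X i j) <= K ^+ 2 ->
  (0 <= width (Gamma X) A B E <= K%:E)%E.
Proof.
move=> K0 t0 XK; rewrite /width unlock.
set S := _ `&` _.
pose F w := [set frobenius_dot (noise_mx A B E w) U | U in S].
pose Q w : R := \sum_j \sum_i
  sqr_gap t (j \in max_cols X) (X i j) (noise_mx A B E w i j).
have Q0 w : 0 <= Q w.
  by apply: sumr_ge0 => j _; apply: sumr_ge0 => i _; exact: sqr_gap_ge0.
have ubF w : ubound (F w) ((Q w / K + K) / 2).
  by move=> _ [U [XU U1] <-]; apply: Gamma_dot_le => //; exact: ltW.
have mQ : measurable_fun [set: T] Q.
  apply: measurable_sum => j; apply: measurable_sum => i.
  by apply: measurable_sqr_gap; exact: measurable_noise_mx.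
have intQ : (\int[P]_w (Q w)%:E <= (K ^+ 2)%:E)%E.
  apply: le_trans (_ : _ <= (\sum_j \sum_i
    sqr_gap_mean t (j \in max_cols X) (X i j))%:E)%E _; last by rewrite lee_fin.
  under eq_integral do rewrite -sumEFin.
  rewrite ge0_integral_sum//.
  - rewrite -sumEFin; apply: lee_sum => j _.
    under eq_integral do rewrite -sumEFin.
    rewrite ge0_integral_sum//.
    + rewrite -sumEFin; apply: lee_sum => i _.
      by apply: sqr_gap_mean_ge => //; [exact: measurable_noise_mx|exact: mgf].
    + move=> i; apply/measurable_EFinP.
      by apply: measurable_sqr_gap; exact: measurable_noise_mx.
    + by move=> i w _; rewrite lee_fin sqr_gap_ge0.
  - move=> j; apply/measurable_EFinP; apply: measurable_sum => i.
    by apply: measurable_sqr_gap; exact: measurable_noise_mx.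
  - by move=> j w _; rewrite lee_fin; apply: sumr_ge0 => i _; exact: sqr_gap_ge0.
apply/andP; split.
- have [S0|/set0P[U SU]] := eqVneq S set0.
    by apply: integral_ge0 => w _; rewrite S0 image_set0 sup0.
  rewrite -(frobenius_dot_mean0 U); apply: le_integral_pointwise => w.
  rewrite lee_fin; apply: ub_le_sup; last by exists U.
  by exists ((Q w / K + K) / 2); exact: ubF.
- apply: (@le_trans _ _ (\int[P]_w ((Q w / K + K) / 2)%:E)%E).
    apply: le_integral_pointwise => w; rewrite lee_fin.
    (* When no unit vector lies in the cone, [sup] takes its default value 0, below the nonnegative
       bound. *)
    have [F0|/set0P F0] := eqVneq (F w) set0; last by apply: ge_sup => //; exact: ubF.
    by rewrite [X in sup X]F0 sup0 divr_ge0 ?addr_ge0 ?divr_ge0 ?(ltW K0).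
  have -> : (\int[P]_w ((Q w / K + K) / 2)%:E =
      (2^-1 / K)%:E * \int[P]_w (Q w)%:E + (K / 2)%:E)%E.
    under eq_integral.
      move=> w _; rewrite (_ : (Q w / K + K) / 2 = 2^-1 / K * Q w + K / 2); last by ring.
      rewrite EFinD EFinM; over.
    have c0 : 0 <= 2^-1 / K by rewrite divr_ge0// ltW.
    have mQ' : measurable_fun [set: T] (fun w => (Q w)%:E) by exact/measurable_EFinP.
    rewrite ge0_integralD//.
    + rewrite ge0_integralZl//; first by rewrite integral_cst//= probability_setT mule1.
      by move=> w _; rewrite lee_fin.
    + by move=> w _; rewrite -EFinM lee_fin mulr_ge0.
    + exact: emeasurable_funM.
    + by move=> w _; rewrite lee_fin divr_ge0// ltW.
  apply: (@le_trans _ _ ((2^-1 / K)%:E * (K ^+ 2)%:E + (K / 2)%:E)%E).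
    by rewrite leeD2r// lee_wpmul2l// lee_fin divr_ge0// ltW.
  rewrite -EFinM -EFinD lee_fin le_eqVlt; apply/orP; left; apply/eqP.
  by field; rewrite gt_eqF.
Qed.

End WidthBound.

Theorem lemma6p1 (R : realType) :
  exists c : R, 0 < c /\
  forall (m n s : nat) (X : 'M[R]_n)
    (d : measure_display) (T : measurableType d) (P : probability T R)
    (A B : 'I_m * 'I_n -> {RV P >-> R}) (E : 'I_m * 'I_m -> {RV P >-> R}),
  (0 < m)%N -> (0 < n)%N ->
  (forall j : 'I_n, sparse s (col j X)) ->
  (forall p, std_normal (A p)) -> mutually_independent A ->
  (forall p, std_normal (B p)) -> mutually_independent B ->
  (forall p, rademacher (E p)) -> mutually_independent E ->
  independent_systems P (sigma_of A) (sigma_of B) ->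
  independent_systems P (sigma_of E) <<s sigma_of A `|` sigma_of B >> ->
  let r := #|max_cols X| in
  let W := width (Gamma X) A B E in
  (W ^+ 2 <=
     (1 + n%:R ^+ 2
      - r%:R * (n%:R - s%:R * ln (c * n%:R ^+ 2 * r%:R) ^+ 2))%:E)%E
  /\ (r = n ->
      (W ^+ 2 <= (1 + n%:R * s%:R * ln (c * n%:R ^+ 3) ^+ 2)%:E)%E).
Proof.
exists (expR 10); split; first exact: expR_gt0.
move=> m n s X d T P A B E m0 n0 Xs nA iA nB iB rE iE AB EAB r W.
have r0 : (0 < r)%N by exact: max_cols_gt0.
have rn : (r <= n)%N by rewrite -[leqRHS]card_ord; exact: max_card.
set L := ln (expR 10 * n%:R ^+ 2 * r%:R).
have [t [LE t0 tail]] : exists t, [/\ L = t + 1, 0 < t &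
    n%:R * r%:R * (125 / 12 * expR (- (4 / 5 * t))) <= 1].
  by exists (L - 1); rewrite subrK; split=> //; apply threshold_log; rewrite r0.
have main : (W ^+ 2 <=
    (1 + n%:R ^+ 2 - r%:R * (n%:R - s%:R * L ^+ 2))%:E)%E.
  set K2 := 1 + _ - _.
  have rs0 : 0 <= r%:R * s%:R :> R by rewrite mulr_ge0.
  (* As [r <= n], the product [r n] is at most [n^2], so [K2 >= 1] and its square root can serve as
     [K]. *)
  have K2_gt0 : 0 < K2.
    have : r%:R * n%:R <= n%:R ^+ 2 :> R by rewrite expr2 ler_wpM2r// ler_nat.
    by have := mulr_ge0 rs0 (sqr_ge0 L); rewrite /K2; lra.
  have bound : \sum_j \sum_i sqr_gap_mean t (j \in max_cols X) (X i j) <=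
      Num.sqrt K2 ^+ 2.
    rewrite sqr_sqrtr ?(ltW K2_gt0)//; apply: le_trans (sum_sqr_gap_mean_le t Xs) _.
    (* The shift [t = L - 1] lets [L ^+ 2] absorb the variance term 1; the leading 1 of [K2] absorbs
       the tail. *)
    have tL : 1 + t ^+ 2 <= L ^+ 2.
      by rewrite LE sqrrD mulr1 expr1n -mulr_natr; lra.
    by have := ler_wpM2l rs0 tL; rewrite -/r /K2; lra.
  have mgf i j u : u ^+ 2 < 1 ->
      (\int[P]_w (expR (u * noise_mx A B E w i j))%:E <=
       ((Num.sqrt (1 - u ^+ 2))^-1)%:E)%E by exact: noise_mgf.
  have K_gt0 : 0 < Num.sqrt K2 by rewrite sqrtr_gt0.
  have /andP[] := width_Gamma_bounds mgf K_gt0 t0 bound.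
  rewrite -/W; case: W => [v| |]//; rewrite !lee_fin => v0 vK.
  rewrite -expr2 -[leRHS]sqr_sqrtr ?(ltW K2_gt0)//.
  by rewrite lerXn2r// nnegrE ltW.
split=> // rnE; apply: le_trans main _.
rewrite lee_fin /L rnE.
rewrite (_ : expR 10 * n%:R ^+ 2 * n%:R = expR 10 * n%:R ^+ 3); last by ring.
by set l := ln _; lra.
Qed.
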